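(* Let $A$ be a compliant Banach algebra with a bounded approximate identity. The map $I\mapsto\overline{I}^{w^*}$ (weak*-closure in $M(A)$) defines a bijective correspondence between the closed left ideals $I$ of $A$ and the weak*-closed left ideals of $M(A)$. The inverse is given by $J\mapsto A\cap J$, for $J$ a weak*-closed left ideal of $M(A)$.
   Context: A Banach algebra $A$ is faithful if $Ax=\{0\}$ implies $x=0$ and $xA=\{0\}$ implies $x=0$ ($x\in A$). The multiplier algebra $M(A)$ of a faithful Banach algebra $A$ is the unital Banach algebra of pairs $\mu=(L,R)$ of bounded linear maps $A\to A$ with $aL(b)=R(a)b$ for all $a,b\in A$, with product $(L,R)(L',R')=(LL',R'R)$ and norm $\max(\|L\|,\|R\|)$; one writes $\mu a=L(a)$ and $a\mu=R(a)$. $A$ is identified with its image in $M(A)$ under the canonical map sending $a$ to (left multiplication by $a$, right multiplication by $a$). A dual Banach algebra is a Banach algebra that is (isomorphically) a dual Banach space in such a way that multiplication is separately weak*-continuous. A Banach algebra $A$ is compliant if it is faithful and $M(A)$ is a dual Banach algebra in such a way that, for each $a\in A$, the maps $M(A)\to A$, $\mu\mapsto\mu a$ and $\mu\mapsto a\mu$, are continuous from the weak*-topology of $M(A)$ to the weak topology of $A$; weak*-closures in $M(A)$ refer to this dual structure. Bounded approximate identities are two-sided. Closed ideals of $A$ are norm-closed. *)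

(* Defs.v *)
From HB Require Import structures.
From mathcomp Require Import all_boot all_order all_algebra all_classical reals complex.
From mathcomp Require Import topology normedtype.
Set Implicit Arguments.
Unset Strict Implicit.
Unset Printing Implicit Defensive.
Import Order.TTheory GRing.Theory Num.Theory numFieldNormedType.Exports.
Local Open Scope classical_set_scope.
Local Open Scope ring_scope.
Local Open Scope complex_scope.

(* The scalars are R[i], for R : realType.  The norm of a normedModType R[i]
   takes its values in R[i] itself (in its nonnegative reals).  As R[i] carries
   no topology in the library, the scalar field seen as a normed space is
   R[i]^o. *)

Section BoundedLinear.
Context {R : realType} (X Y : normedModType R[i]).

Definition bounded_linear : {pred X -> Y} := fun f =>
  `[< linear f /\ exists M : R[i], forall x, `|f x| <= M * `|x| >].

Record blin := Blin { blin_fun :> X -> Y; _ : blin_fun \in bounded_linear }.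

HB.instance Definition _ := [isSub for blin_fun].
HB.instance Definition _ := [Choice of blin by <:].

Lemma bounded_linear_submod : submod_closed bounded_linear.
Proof.
split.
  apply/asboolP; split=> [a x y|]; first by rewrite /= scaler0 addr0.
  by exists 0 => x; rewrite normr0 mul0r.
move=> a f g /asboolP[lf [M fM]] /asboolP[lg [N gN]]; apply/asboolP; split.
  move=> k x y; rewrite !fctE lf lg !scalerDr !scalerA mulrC.
  by rewrite addrACA.
exists (`|a| * M + N) => x; rewrite !fctE mulrDl.
rewrite (le_trans (ler_normD _ _))// lerD// normrZ -mulrA.
exact: ler_wpM2l.
Qed.

HB.instance Definition _ :=
  GRing.isSubmodClosed.Build R[i] (X -> Y) bounded_linear bounded_linear_submod.
HB.instance Definition _ := [SubChoice_isSubLmodule of blin by <:].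

Lemma blin_linear (f : blin) : linear f.
Proof. by case: f => f /= /asboolP[]. Qed.

HB.instance Definition _ (f : blin) :=
  GRing.isLinear.Build R[i] X Y *:%R f (blin_linear f).

Lemma blinP (f g : blin) : f =1 g -> f = g.
Proof. by move=> fg; apply/val_inj/funext. Qed.

Lemma blinDE (f g : blin) x : (f + g) x = f x + g x. Proof. by []. Qed.
Lemma blinNE (f : blin) x : (- f) x = - f x. Proof. by []. Qed.
Lemma blinZE (a : R[i]) (f : blin) x : (a *: f) x = a *: f x. Proof. by []. Qed.
Lemma blin0E x : (0 : blin) x = 0. Proof. by []. Qed.

(* Norms being R[i]-valued, the supremum is taken over their real parts. *)
Definition opnorm (f : blin) : R[i] :=
  (sup [set complex.Re `|f x| | x in [set x : X | `|x| <= 1]])%:C.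

Let ReK (z : R[i]) : 0 <= z -> (complex.Re z)%:C = z.
Proof. by move=> /ger0_real/complex_realP[r ->]. Qed.

Let has_sup_opnorm (f : blin) :
  has_sup [set complex.Re `|f x| | x in [set x : X | `|x| <= 1]].
Proof.
split; first by exists (complex.Re `|f 0|); exists 0 => //=; rewrite normr0 ler01.
case: f => f /= /asboolP[_ [M fM]]; exists (complex.Re `|M|) => _ [x /= x1 <-].
rewrite -lecR !ReK ?normr_ge0//.
have Mx := fM x.
rewrite (le_trans _ (_ : `|M| * `|x| <= _))//; last first.
  by rewrite ler_piMr.
by rewrite -[`|x|]normr_id -normrM ger0_norm// (le_trans _ Mx).
Qed.

Lemma opnorm_ge0 (f : blin) : 0 <= opnorm f.
Proof.
rewrite /opnorm lecR.
suff S0 : [set complex.Re `|f x| | x in [set x : X | `|x| <= 1]] 0.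
  exact: (ub_le_sup (has_sup_opnorm f).2 S0).
by exists 0; rewrite /= ?linear0 normr0 ?ler01.
Qed.

Lemma ler_opnorm (f : blin) x : `|f x| <= opnorm f * `|x|.
Proof.
have [->|x0] := eqVneq x 0; first by rewrite linear0 !normr0 mulr0.
have nx0 : 0 < `|x| by rewrite normr_gt0.
rewrite -ler_pdivrMr// mulrC.
have -> : `|x|^-1 * `|f x| = `|f (`|x|^-1 *: x)|.
  by rewrite linearZ normrZ normfV normr_id.
rewrite -[leLHS]ReK// lecR.
apply: (ub_le_sup (has_sup_opnorm f).2).
by exists (`|x|^-1 *: x) => //=; rewrite normfZV.
Qed.

Lemma opnorm_le (f : blin) (M : R[i]) :
  0 <= M -> (forall x, `|f x| <= M * `|x|) -> opnorm f <= M.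
Proof.
move=> M0 fM; rewrite -(ReK M0) lecR; apply: ge_sup.
  exact: (has_sup_opnorm f).1.
move=> _ [x /= x1 <-]; rewrite -lecR !ReK//.
by rewrite (le_trans (fM x))// ler_piMr.
Qed.

Lemma opnormD f g : opnorm (f + g) <= opnorm f + opnorm g.
Proof.
apply: opnorm_le => [|x]; first by rewrite addr_ge0 ?opnorm_ge0.
by rewrite mulrDl (le_trans (ler_normD _ _))// lerD// ler_opnorm.
Qed.

Lemma opnorm_eq0 f : opnorm f = 0 -> f = 0.
Proof.
move=> f0; apply: blinP => x; apply/eqP; rewrite -normr_le0.
by rewrite (le_trans (ler_opnorm f x))// f0 mul0r.
Qed.

Lemma opnormZ (a : R[i]) f : opnorm (a *: f) = `|a| * opnorm f.
Proof.
have le b g : opnorm (b *: g) <= `|b| * opnorm g.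
  apply: opnorm_le => [|x]; first by rewrite mulr_ge0 ?opnorm_ge0.
  by rewrite blinZE normrZ -mulrA ler_wpM2l// ler_opnorm.
apply/eqP; rewrite eq_le le /=.
have [->|a0] := eqVneq a 0; first by rewrite normr0 mul0r opnorm_ge0.
rewrite mulrC -ler_pdivlMr ?normr_gt0// mulrC -normfV.
by rewrite -{1}[f](scalerK a0).
Qed.

HB.instance Definition _ :=
  @Lmodule_isNormed.Build R[i] blin opnorm opnormD opnormZ opnorm_eq0.

End BoundedLinear.

Section Completeness.
Context {R : realType}.

Lemma lipschitz_cauchy (X Y : normedModType R[i]) (h : X -> Y) (k : R[i])
    (F : set_system X) : ProperFilter F -> 0 <= k ->
  (forall x y, `|h x - h y| <= k * `|x - y|) -> cauchy F -> cauchy (h @ F).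
Proof.
move=> FF k0 hk cF.
apply/cauchy_ballP => e e0.
have d0 : 0 < e / (k + 1) by rewrite divr_gt0// ltr_wpDl.
have /cauchy_ballP /(_ _ d0) := cF.
rewrite !near_simpl.
case=> -[P Q] /= [FP FQ] PQ.
exists ((h @` P), (h @` Q)).
  by split; [apply: filterS FP|apply: filterS FQ] => x Px; exists x.
move=> [_ _] [/= [x Px <-] [y Qy <-]].
have /= := PQ (x, y) (conj Px Qy).
rewrite -!ball_normE /= => xy.
apply: le_lt_trans (hk _ _) _.
have [->|k_neq0] := eqVneq k 0; first by rewrite mul0r.
have kp : 0 < k by rewrite lt_def k_neq0.
rewrite (lt_trans (_ : _ < k * (e / (k + 1))))//; first by rewrite ltr_pM2l.
rewrite mulrCA gtr_pMr// ltr_pdivrMr ?mul1r; last by rewrite ltr_wpDl.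
by rewrite ltrDl.
Qed.

Context (X : normedModType R[i]) (Y : completeNormedModType R[i]).

Lemma blin_complete (F : set_system (blin X Y)) :
  ProperFilter F -> cauchy F -> cvg F.
Proof.
move=> FF cF.
have cvF x : cvg ((fun f : blin X Y => f x) @ F).
  apply: cauchy_cvg; apply: (@lipschitz_cauchy _ _ _ `|x|) => // f g.
  by rewrite -blinNE -blinDE mulrC ler_opnorm.
pose g x := lim ((fun f : blin X Y => f x) @ F).
have gP x : (fun f : blin X Y => f x) @ F --> g x by exact: cvF.
have gE (e : R[i]) : 0 < e ->
    \forall f \near F, forall x : X, `|(f : blin X Y) x - g x| <= e * `|x|.
  move=> e0; have /cauchy_ballP /(_ _ e0) := cF.
  rewrite near_simpl => -[[P Q] /= [FP FQ] PQ].
  apply: filterS FP => f Pf x; apply/ler_addgt0Pr => d d0.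
  have /cvgrPdist_lt /(_ d d0) gd := gP x.
  have [f' [/= Qf' gf']] := filter_ex (filterI FQ gd).
  have /= := PQ (f, f') (conj Pf Qf'); rewrite -ball_normE /= => ff'.
  rewrite -(subrKA (f' x)) (le_trans (ler_normD _ _))// lerD//.
    rewrite -blinNE -blinDE (le_trans (ler_opnorm _ _))// ler_wpM2r//.
    exact: ltW.
  by rewrite distrC ltW.
have glin : linear g.
  move=> a x y; apply: (@cvg_unique _ (@norm_hausdorff _ Y)
    ((fun f : blin X Y => f (a *: x + y)) @ F)); first exact: gP.
  have -> : (fun f : blin X Y => f (a *: x + y)) = (fun f => a *: f x + f y).
    by apply/funext => f; exact: blin_linear.
  by apply: cvgD (gP y); apply: cvgZr (gP x).
have gbl : g \in @bounded_linear R X Y.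
  apply/asboolP; split => //.
  have [f fg] := filter_ex (gE 1 ltr01).
  exists (opnorm f + 1) => x; rewrite mulrDl.
  rewrite -[g x](subKr (f x)) (le_trans (ler_normB _ _))// lerD//.
  exact: ler_opnorm.
apply/cvg_ex; exists (Blin gbl); apply/cvgrPdist_le => e e0.
apply: filterS (gE _ e0) => f fg; rewrite distrC.
by apply: opnorm_le; [exact: ltW|exact: fg].
Qed.

HB.instance Definition _ := Uniform_isComplete.Build (blin X Y) blin_complete.

End Completeness.

HB.mixin Record CompleteNormedModule_isBanachAlgebra (K : numFieldType) A
    & CompleteNormedModule K A := {
  bamul : A -> A -> A;
  bamulA : associative bamul;
  bamulDl : left_distributive bamul +%R;
  bamulDr : right_distributive bamul +%R;
  bamulZl : forall (k : K) x y, bamul (k *: x) y = k *: bamul x y;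
  bamulZr : forall (k : K) x y, bamul x (k *: y) = k *: bamul x y;
  ler_norm_bamul : forall x y, `|bamul x y| <= `|x| * `|y|;
}.

#[short(type="banachAlgType")]
HB.structure Definition BanachAlgebra (K : numFieldType) :=
  {A of CompleteNormedModule K A & CompleteNormedModule_isBanachAlgebra K A}.

Notation "x ** y" := (bamul x y) (at level 40, left associativity) : ring_scope.

Section Faithful.
Context {K : numFieldType} (A : banachAlgType K).

Definition faithful := forall x : A,
  ((forall a, a ** x = 0) -> x = 0) /\ ((forall a, x ** a = 0) -> x = 0).

(* A net indexed by the directed preordered set (I, le) converges when its
   filter of tails does. *)
Definition directed_preorder (I : Type) (le : I -> I -> Prop) :=
  [/\ inhabited I, (forall i, le i i),
      (forall i j k, le i j -> le j k -> le i k) &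
      (forall i j, exists k, le i k /\ le j k)].

Definition tails (I : Type) (le : I -> I -> Prop) : set_system I :=
  [set P | exists i, forall j, le i j -> P j].

Definition has_bounded_approximate_identity :=
  exists (I : Type) (le : I -> I -> Prop) (e : I -> A),
    [/\ directed_preorder le,
        (exists M : K, forall i, `|e i| <= M) &
        forall a, (e i ** a @[i --> tails le] --> a) /\
                  (a ** e i @[i --> tails le] --> a)].

Definition left_ideal (I : set A) :=
  [/\ I 0, (forall x y, I x -> I y -> I (x + y)),
      (forall (k : K) x, I x -> I (k *: x)) &
      (forall a x, I x -> I (a ** x))].

Definition closed_left_ideal (I : set A) := left_ideal I /\ closed I.

End Faithful.

Section Multiplier.
Context {R : realType} (A : banachAlgType R[i]).

Definition is_multiplier : {pred (blin A A * blin A A)%type} := fun LR =>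
  `[< forall a b, a ** LR.1 b = LR.2 a ** b >].

Record multiplier :=
  Multiplier { multLR : (blin A A * blin A A)%type;
               _ : multLR \in is_multiplier }.

HB.instance Definition _ := [isSub for multLR].
HB.instance Definition _ := [Choice of multiplier by <:].

(* For m in M(A), multL m a is "m a" and multR m a is "a m". *)
Definition multL (m : multiplier) : blin A A := (multLR m).1.
Definition multR (m : multiplier) : blin A A := (multLR m).2.

Lemma multP (m : multiplier) a b : a ** multL m b = multR m a ** b.
Proof. by have /asboolP := valP m; apply. Qed.

Lemma bamul0r (a : A) : 0 ** a = 0.
Proof. by have := bamulZl (0 : R[i]) 0 a; rewrite !scale0r. Qed.
Lemma bamulr0 (a : A) : a ** 0 = 0.
Proof. by have := bamulZr (0 : R[i]) a 0; rewrite !scale0r. Qed.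
Lemma bamulrN (a b : A) : a ** - b = - (a ** b).
Proof. by rewrite -(scaleN1r b) bamulZr scaleN1r. Qed.
Lemma bamulNr (a b : A) : - a ** b = - (a ** b).
Proof. by rewrite -(scaleN1r a) bamulZl scaleN1r. Qed.
Lemma bamulBr (a b c : A) : a ** (b - c) = a ** b - a ** c.
Proof. by rewrite bamulDr bamulrN. Qed.
Lemma bamulBl (a b c : A) : (a - b) ** c = a ** c - b ** c.
Proof. by rewrite bamulDl bamulNr. Qed.

Lemma is_multiplier_submod : submod_closed is_multiplier.
Proof.
split; first by apply/asboolP => a b /=; rewrite bamul0r bamulr0.
move=> k m n /asboolP mM /asboolP nM; apply/asboolP => a b.
rewrite -[LHS]/(a ** (k *: m.1 b + n.1 b)) -[RHS]/((k *: m.2 a + n.2 a) ** b).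
by rewrite bamulDr bamulDl bamulZr bamulZl mM nM.
Qed.

HB.instance Definition _ := GRing.isSubmodClosed.Build R[i]
  (blin A A * blin A A)%type is_multiplier is_multiplier_submod.
HB.instance Definition _ := [SubChoice_isSubLmodule of multiplier by <:].

Definition multnorm (m : multiplier) : R[i] := Num.max `|multL m| `|multR m|.

Let multLR_comparable (m : multiplier) : `|multL m| >=< `|multR m|.
Proof. by rewrite real_comparable ?ger0_real. Qed.

Lemma multnorm_geL (m : multiplier) : `|multL m| <= multnorm m.
Proof. by rewrite /multnorm comparable_le_max// lexx. Qed.

Lemma multnorm_geR (m : multiplier) : `|multR m| <= multnorm m.
Proof. by rewrite /multnorm comparable_le_max// lexx orbT. Qed.

Lemma multnorm_le (m : multiplier) (M : R[i]) :
  `|multL m| <= M -> `|multR m| <= M -> multnorm m <= M.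
Proof. by move=> LM RM; rewrite /multnorm comparable_ge_max// LM. Qed.

Lemma multnormD m n : multnorm (m + n) <= multnorm m + multnorm n.
Proof.
apply: multnorm_le; rewrite (le_trans (ler_normD _ _))// lerD//;
  by [exact: multnorm_geL|exact: multnorm_geR].
Qed.

Lemma multnormZ (k : R[i]) m : multnorm (k *: m) = `|k| * multnorm m.
Proof.
have le h (n : multiplier) : multnorm (h *: n) <= `|h| * multnorm n.
  by apply: multnorm_le; rewrite normrZ ler_wpM2l//;
    [exact: multnorm_geL|exact: multnorm_geR].
apply/eqP; rewrite eq_le le /=.
have [->|k0] := eqVneq k 0.
  by rewrite normr0 mul0r (le_trans _ (multnorm_geL _)).
rewrite mulrC -ler_pdivlMr ?normr_gt0// mulrC -normfV.
by rewrite -{1}[m](scalerK k0).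
Qed.

Lemma multnorm_eq0 m : multnorm m = 0 -> m = 0.
Proof.
move=> m0; have := multnorm_geL m; have := multnorm_geR m.
rewrite m0 !normr_le0 /multL /multR => /eqP T0 /eqP L0.
by apply: val_inj; rewrite /= [LHS]surjective_pairing T0 L0.
Qed.

HB.instance Definition _ := @Lmodule_isNormed.Build R[i] multiplier
  multnorm multnormD multnormZ multnorm_eq0.

Lemma multiplier_complete (F : set_system multiplier) :
  ProperFilter F -> cauchy F -> cvg F.
Proof.
move=> FF cF.
have cvL : cvg (multL @ F).
  apply: cauchy_cvg; apply: (@lipschitz_cauchy _ _ _ _ 1) => // m n.
  by rewrite mul1r (multnorm_geL (m - n)).
have cvR : cvg (multR @ F).
  apply: cauchy_cvg; apply: (@lipschitz_cauchy _ _ _ _ 1) => // m n.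
  by rewrite mul1r (multnorm_geR (m - n)).
pose L := lim (multL @ F); pose T := lim (multR @ F).
have LTM : (L, T) \in is_multiplier.
  apply/asboolP => a b /=; apply/eqP; rewrite -subr_eq0 -normr_le0.
  apply/ler_addgt0Pr => e e0; rewrite add0r.
  pose c := `|a| * `|b| + `|a| * `|b| + 1.
  have c0 : 0 < c by rewrite ltr_wpDl// addr_ge0// mulr_ge0.
  have d0 : 0 < e / c by rewrite divr_gt0.
  have /cvgrPdist_lt /(_ _ d0) cL := cvL.
  have /cvgrPdist_lt /(_ _ d0) cR := cvR.
  have [m [mL mR]] := filter_ex (filterI cL cR).
  have -> : a ** L b - T a ** b = a ** (L - multL m) b - (T - multR m) a ** b.
    by rewrite !blinDE !blinNE bamulBr bamulBl multP opprB addrA subrK.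
  apply: (@le_trans _ _ (`|a| * (e / c * `|b|) + e / c * `|a| * `|b|)).
    rewrite (le_trans (ler_normB _ _))// lerD// (le_trans (ler_norm_bamul _ _))//.
      by rewrite ler_wpM2l// (le_trans (ler_opnorm _ _))// ler_wpM2r// ltW.
    by rewrite ler_wpM2r// (le_trans (ler_opnorm _ _))// ler_wpM2r// ltW.
  rewrite mulrCA -mulrA -mulrDr -mulrA ler_piMr ?ltW//.
  by rewrite mulrC ltr_pdivrMr// mul1r ltrDl.
apply/cvg_ex; exists (Multiplier LTM); apply/cvgrPdist_le => e e0.
have /cvgrPdist_le /(_ _ e0) cL := cvL.
have /cvgrPdist_le /(_ _ e0) cR := cvR.
by apply: filterS (filterI cL cR) => m [mL mR]; exact: multnorm_le.
Qed.

HB.instance Definition _ :=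
  Uniform_isComplete.Build multiplier multiplier_complete.

Lemma bounded_linear_lip (f : A -> A) (M : R[i]) :
  linear f -> (forall x, `|f x| <= M * `|x|) -> f \in @bounded_linear R A A.
Proof. by move=> lf fM; apply/asboolP; split=> //; exists M. Qed.

Lemma blin_comp_subproof (f g : blin A A) :
  (fun x => f (g x)) \in @bounded_linear R A A.
Proof.
apply: (@bounded_linear_lip _ (opnorm f * opnorm g)) => [k x y|x].
  by rewrite !linearP.
rewrite (le_trans (ler_opnorm _ _))// -mulrA ler_wpM2l ?opnorm_ge0//.
exact: ler_opnorm.
Qed.

Definition blin_comp (f g : blin A A) : blin A A :=
  Blin (blin_comp_subproof f g).

Lemma opnorm_comp (f g : blin A A) : `|blin_comp f g| <= `|f| * `|g|.
Proof.
change (opnorm (blin_comp f g) <= opnorm f * opnorm g).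
apply: opnorm_le => [|x]; first by rewrite mulr_ge0 ?opnorm_ge0.
rewrite (le_trans (ler_opnorm f (g x)))// -mulrA ler_wpM2l ?opnorm_ge0//.
exact: ler_opnorm.
Qed.

Lemma multmul_subproof (m n : multiplier) :
  (blin_comp (multL m) (multL n), blin_comp (multR n) (multR m))
    \in is_multiplier.
Proof. by apply/asboolP => a b /=; rewrite !multP. Qed.

(* The right components compose in reverse order. *)
Definition multmul (m n : multiplier) := Multiplier (multmul_subproof m n).

Lemma mult_eq (m n : multiplier) :
  multL m =1 multL n -> multR m =1 multR n -> m = n.
Proof.
case: m n => [[L T] ?] [[L' T'] ?]; rewrite /multL /multR /= => LL TT.
by apply: val_inj => /=; rewrite (blinP LL) (blinP TT).
Qed.

Lemma multmulA : associative multmul.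
Proof. by move=> m n p; apply: mult_eq. Qed.
Lemma multmulDl : left_distributive multmul +%R.
Proof.
by move=> m n p; apply: mult_eq => x //; rewrite /multR /= linearD.
Qed.
Lemma multmulDr : right_distributive multmul +%R.
Proof.
by move=> m n p; apply: mult_eq => x //; rewrite /multL /= linearD.
Qed.
Lemma multmulZl (k : R[i]) m n : multmul (k *: m) n = k *: multmul m n.
Proof. by apply: mult_eq => x //; rewrite /multR /= linearZ. Qed.
Lemma multmulZr (k : R[i]) m n : multmul m (k *: n) = k *: multmul m n.
Proof. by apply: mult_eq => x //; rewrite /multL /= linearZ. Qed.
Lemma ler_norm_multmul m n : `|multmul m n| <= `|m| * `|n|.
Proof.
apply: multnorm_le; rewrite (le_trans (opnorm_comp _ _))//.
  by rewrite ler_pM ?multnorm_geL.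
by rewrite mulrC ler_pM ?multnorm_geR.
Qed.

HB.instance Definition _ := CompleteNormedModule_isBanachAlgebra.Build R[i]
  multiplier multmulA multmulDl multmulDr multmulZl multmulZr ler_norm_multmul.

Lemma id_bounded : id \in @bounded_linear R A A.
Proof. by apply: (@bounded_linear_lip _ 1) => // x; rewrite mul1r. Qed.

Lemma mult1_subproof : (Blin id_bounded, Blin id_bounded) \in is_multiplier.
Proof. by apply/asboolP. Qed.

Definition mult1 : multiplier := Multiplier mult1_subproof.

Lemma mult1m (m : multiplier) : mult1 ** m = m.
Proof. exact: mult_eq. Qed.
Lemma multm1 (m : multiplier) : m ** mult1 = m.
Proof. exact: mult_eq. Qed.

Lemma lmul_bounded (a : A) : bamul a \in @bounded_linear R A A.
Proof.
apply: (@bounded_linear_lip _ `|a|) => [k x y|x]; last exact: ler_norm_bamul.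
by rewrite bamulDr bamulZr.
Qed.

Lemma rmul_bounded (a : A) : bamul^~ a \in @bounded_linear R A A.
Proof.
apply: (@bounded_linear_lip _ `|a|) => [k x y|x].
  by rewrite bamulDl bamulZl.
by rewrite mulrC; exact: ler_norm_bamul.
Qed.

Lemma mult_of_subproof (a : A) :
  (Blin (lmul_bounded a), Blin (rmul_bounded a)) \in is_multiplier.
Proof. by apply/asboolP => b c /=; rewrite bamulA. Qed.

(* The canonical map A -> M(A). *)
Definition mult_of (a : A) : multiplier := Multiplier (mult_of_subproof a).

End Multiplier.

Section Duality.
Context {R : realType}.

Definition dual (X : normedModType R[i]) := blin X R[i]^o.

HB.instance Definition _ (X : normedModType R[i]) := NormedModule.on (dual X).

Definition weak (X : normedModType R[i]) : Type :=
  @initial_topology X {ptws dual X -> R[i]^o} (fun x f => f x).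

HB.instance Definition _ (X : normedModType R[i]) := Topological.on (weak X).

Definition weakstar (X : normedModType R[i]) : Type :=
  @initial_topology (dual X) {ptws X -> R[i]^o} (fun f x => f x).

HB.instance Definition _ (X : normedModType R[i]) :=
  Topological.on (weakstar X).

(* A way of being (isomorphically, not necessarily isometrically) a dual Banach
   space. *)
Record predual (B : normedModType R[i]) := Predual {
  pd_space : completeNormedModType R[i];
  pd_iso : {linear B -> dual pd_space};
  pd_inv : dual pd_space -> B;
  pd_isoK : cancel pd_iso pd_inv;
  pd_invK : cancel pd_inv pd_iso;
  pd_iso_continuous : continuous pd_iso;
  pd_inv_continuous : continuous pd_inv;
}.

(* B with the weak*-topology transported from the dual of the predual. *)
Definition wstar (B : normedModType R[i]) (P : predual B) : Type :=
  @initial_topology B (weakstar (pd_space P)) (pd_iso P).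

HB.instance Definition _ (B : normedModType R[i]) (P : predual B) :=
  Topological.on (wstar P).

Definition wstar_closure (B : normedModType R[i]) (P : predual B) (S : set B)
  : set B := @closure (wstar P) S.

Definition dual_banach_algebra (B : banachAlgType R[i]) (P : predual B) :=
  forall b : B, continuous ((fun x => b ** x) : wstar P -> wstar P) /\
                continuous ((fun x => x ** b) : wstar P -> wstar P).

Definition wstar_closed_left_ideal (B : banachAlgType R[i]) (P : predual B)
  (J : set B) := left_ideal J /\ @closed (wstar P) J.

(* The witness P is kept explicit: weak*-closures in M(A) refer to it. *)
Definition compliant (A : banachAlgType R[i]) (P : predual (multiplier A)) :=
  [/\ faithful A, dual_banach_algebra P &
      forall a : A, continuous ((fun m => multL m a) : wstar P -> weak A) /\
                    continuous ((fun m => multR m a) : wstar P -> weak A)].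

End Duality.

(* Main.v *)
Require Import Defs.
From HB Require Import structures.
From mathcomp Require Import all_boot all_order all_algebra all_classical reals complex.
From mathcomp Require Import topology normedtype.
Import Order.TTheory GRing.Theory Num.Theory numFieldNormedType.Exports.
Local Open Scope classical_set_scope.
Local Open Scope ring_scope.
Local Open Scope complex_scope.

(* By Hahn-Banach a norm-closed left ideal I of A is weakly closed, so for b in A
   the weak*-to-weak continuous map mu |-> b mu sends the weak*-closure of I into
   I; applying this to b = e_i, where (e_i) is the approximate identity, and
   taking the limit shows that A meets this closure only in I.  Conversely, by
   Banach-Alaoglu (e_i) has a weak*-cluster point in M(A), which must be 1 since
   it acts on A as the identity; as mu |-> mu m is weak*-continuous and e_i m
   lies in A, every weak*-closed left ideal J is the weak*-closure of its
   intersection with A. *)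

(** * Sublinear functionals on real vector spaces and the Hahn-Banach theorem *)

Section Sublinear.
Context {R : realType} {V : lmodType R}.
Implicit Types (p q g : V -> R) (x y z : V).

Definition sublinear p :=
  (forall x y, p (x + y) <= p x + p y) /\
  (forall (r : R) x, 0 < r -> p (r *: x) <= r * p x).

Lemma sublinear0 p : sublinear p -> p 0 = 0.
Proof.
move=> [_ pZ]; apply/eqP; rewrite eq_le; apply/andP; split.
  have := pZ 2^-1 0; rewrite scaler0 invr_gt0 ltr0n => /(_ isT).
  rewrite mulrC ler_pdivlMr ?ltr0n// mulr_natr mulr2n => h.
  by rewrite -(lerD2l (p 0)) addr0.
have := pZ 2 0; rewrite scaler0 ltr0n => /(_ isT).
by rewrite mulr_natl mulr2n -{1}[p 0]addr0 lerD2l.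
Qed.

Lemma sublinearZ p (r : R) x : sublinear p -> 0 <= r -> p (r *: x) = r * p x.
Proof.
move=> sp; rewrite le_eqVlt => /orP[/eqP<-|r0].
  by rewrite scale0r mul0r sublinear0.
apply/eqP; rewrite eq_le sp.2//= -ler_pdivlMl//.
rewrite -{1}[x](scalerK (lt0r_neq0 r0)).
by apply: sp.2; rewrite invr_gt0.
Qed.

Lemma sublinear_opp p x : sublinear p -> - p (- x) <= p x.
Proof.
move=> sp; rewrite lerNl -subr_ge0 opprK addrC.
by rewrite -(sublinear0 p sp) -(subrr x) sp.1.
Qed.

(** The two closure hypotheses turn indices chosen for [x] and [y] into one for [x + y], and
    likewise for positive multiples. It serves for the half-line in [sublinear_at], for a chain of
    functionals, and for the distance to a subspace. *)
Lemma inf_sublinear (T : Type) (D : set T) (f : T -> V -> R) :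
  D !=set0 -> (forall x, has_lbound [set f t x | t in D]) ->
  (forall s t x y, D s -> D t ->
    exists2 u, D u & f u (x + y) <= f s x + f t y) ->
  (forall t (r : R) x, 0 < r -> D t ->
    exists2 u, D u & f u (r *: x) <= r * f t x) ->
  sublinear (fun x => inf [set f t x | t in D]).
Proof.
move=> [t0 Dt0] lb fD fZ.
have ne x : [set f t x | t in D] !=set0 by exists (f t0 x), t0.
have infle t x : D t -> inf [set f t x | t in D] <= f t x.
  by move=> Dt; apply: ge_inf => //; exists t.
split=> [x y|r x r0].
  rewrite -lerBlDr; apply: lb_le_inf => // _ [s Ds <-].
  rewrite lerBlDr -lerBlDl; apply: lb_le_inf => // _ [t Dt <-].
  rewrite lerBlDl; have [u Du uE] := fD s t x y Ds Dt.
  exact: le_trans (infle _ _ Du) uE.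
rewrite -ler_pdivrMl//; apply: lb_le_inf => // _ [t Dt <-].
rewrite ler_pdivrMl//; have [u Du uE] := fZ t r x r0 Dt.
exact: le_trans (infle _ _ Du) uE.
Qed.

(* The largest sublinear minorant [q] of [p] with [q (- y) <= - p y]. *)
Definition sublinear_at p y z : R :=
  inf [set p (z + t *: y) - t * p y | t in [set t : R | 0 <= t]].

(** Subadditivity on [t *: y = (z + t *: y) - z] gives [t * p y <= p (z + t *: y) + p (- z)]. *)
Lemma has_lbound_sublinear_at p y z : sublinear p ->
  has_lbound [set p (z + t *: y) - t * p y | t in [set t : R | 0 <= t]].
Proof.
move=> sp; exists (- p (- z)) => _ [t /= t0 <-].
rewrite lerBrDr addrC lerBlDr -(sublinearZ _ _ _ sp t0).
by apply: le_trans (sp.1 _ _); rewrite [_ + - z]addrC addKr.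
Qed.

Lemma sublinear_at_le p y z t : sublinear p -> 0 <= t ->
  sublinear_at p y z <= p (z + t *: y) - t * p y.
Proof.
by move=> sp t0; apply: ge_inf; [exact: has_lbound_sublinear_at|exists t].
Qed.

Lemma sublinear_at_le0 p y z : sublinear p -> sublinear_at p y z <= p z.
Proof.
move=> sp; have := sublinear_at_le p y z 0 sp (lexx _).
by rewrite scale0r mul0r subr0 addr0.
Qed.

Lemma sublinear_at_sublinear p y : sublinear p -> sublinear (sublinear_at p y).
Proof.
move=> sp; apply: (inf_sublinear _ _ (fun t z => p (z + t *: y) - t * p y)).
- by exists 0 => /=.
- by move=> z; exact: has_lbound_sublinear_at.
- move=> s t x z /= s0 t0; exists (s + t); first exact: addr_ge0.
  rewrite mulrDl opprD addrACA lerD2r scalerDl addrACA.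
  exact: sp.1.
- move=> t r x r0 /= t0; exists (r * t); first by rewrite mulr_ge0// ltW.
  rewrite mulrBr mulrA lerD2r -scalerA -scalerDr.
  exact: sp.2.
Qed.

(** Zorn's lemma for the reversed pointwise order on sublinear minorants of [p]. A nonempty chain is
    bounded by its pointwise infimum, which is finite because [- p (- x) <= - q (- x) <= q x] for
    every minorant [q]. *)
Lemma exists_minimal_sublinear p : sublinear p -> exists q,
  [/\ sublinear q, (forall x, q x <= p x) &
    forall q', sublinear q' -> (forall x, q' x <= q x) ->
      forall x, q x <= q' x].
Proof.
move=> sp; pose T := {q | sublinear q /\ forall x, q x <= p x}.
pose le (s t : T) := `[< forall x, sval t x <= sval s x >].
have [|||q qmax] := @ZL_preorder T (exist _ p (conj sp (fun=> lexx _))) le.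
- by move=> t; apply/asboolP.
- move=> r s t /asboolP rs /asboolP st; apply/asboolP => x.
  exact: le_trans (st x) (rs x).
- move=> F Ftot; have [[q0 Fq0]|F0] := pselect (F !=set0); last first.
    (* The empty chain is bounded by [p] itself. *)
    exists (exist _ p (conj sp (fun=> lexx _))) => s Fs.
    by case: F0; exists s.
  have lbF x : has_lbound [set sval q x | q in F].
    exists (- p (- x)) => _ [[q [sq qp]] _ <-] /=.
    by apply: le_trans (sublinear_opp _ _ sq); rewrite lerN2.
  have infF : sublinear (fun x => inf [set sval q x | q in F]).
    apply: (inf_sublinear _ F (fun t x => sval t x)) => //; first by exists q0.
      (* Two members of the chain are comparable, and the smaller one serves as the common index. *)
      move=> s t x y Fs Ft; have [/asboolP st|/asboolP ts] := Ftot _ _ Fs Ft.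
        exists t => //; apply: le_trans ((svalP t).1.1 _ _) _.
        by rewrite lerD2r.
      exists s => //; apply: le_trans ((svalP s).1.1 _ _) _.
      by rewrite lerD2l.
    by move=> t r x r0 Ft; exists t => //; exact: (svalP t).1.2.
  have infle (t : T) x : F t -> inf [set sval q x | q in F] <= sval t x.
    by move=> Ft; apply: ge_inf => //; exists t.
  have infp x : inf [set sval q x | q in F] <= p x.
    by apply: le_trans ((svalP q0).2 x); exact: infle.
  exists (exist _ (fun x => inf [set sval q x | q in F]) (conj infF infp)).
  by move=> s Fs; apply/asboolP => x; exact: infle.
exists (sval q); split; [exact: (svalP q).1|exact: (svalP q).2|].
move=> q' sq' q'q; have q'p x : q' x <= p x.
  exact: le_trans (q'q x) ((svalP q).2 x).
have /asboolP := qmax (exist _ q' (conj sq' q'p)) (introT (asboolP _) q'q).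
by [].
Qed.

(* Minimality forces [sublinear_at q y = q], whence [q x <= q (x + y) - q y]:
   [q] is superadditive. *)
Lemma minimal_sublinear_scalar q : sublinear q ->
  (forall q', sublinear q' -> (forall x, q' x <= q x) ->
    forall x, q x <= q' x) ->
  scalar q.
Proof.
move=> sq qmin.
have qD x y : q (x + y) = q x + q y.
  apply/eqP; rewrite eq_le sq.1 -lerBrDr.
  apply: le_trans (qmin _ (sublinear_at_sublinear _ y sq) _ x) _.
    by move=> z; exact: sublinear_at_le0.
  by have := sublinear_at_le q y x 1 sq ler01; rewrite scale1r mul1r.
have qN x : q (- x) = - q x.
  by apply/eqP; rewrite -subr_eq0 opprK -qD addNr sublinear0.
move=> r x y; rewrite qD; congr +%R.
have [r0|r0] := leP 0 r; first exact: sublinearZ.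
by rewrite -[r]opprK scaleNr qN (sublinearZ q) ?mulNr// oppr_ge0 ltW.
Qed.

(* Hahn-Banach *)
Theorem exists_dominated_scalar p x : sublinear p ->
  exists g, [/\ scalar g, (forall y, g y <= p y) & g x = p x].
Proof.
move=> sp.
(* Minimality is taken below [sublinear_at p x] rather than [p]: at [- x] this gives
   [g (- x) <= - p x], hence [p x <= g x]. *)
have [g [sg gp gmin]] :=
  exists_minimal_sublinear _ (sublinear_at_sublinear _ x sp).
have lg := minimal_sublinear_scalar g sg gmin.
have gp' y : g y <= p y by apply: le_trans (gp y) _; exact: sublinear_at_le0.
exists g; split=> //; apply/eqP; rewrite eq_le gp'/=.
have := lg (-1) x 0; rewrite (sublinear0 _ sg) !addr0 scaleN1r mulN1r => gN.
rewrite -lerN2 -gN; apply: le_trans (gp _) _.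
have := sublinear_at_le p x (- x) 1 sp ler01.
by rewrite scale1r addNr (sublinear0 _ sp) mul1r sub0r.
Qed.

End Sublinear.

(** * Complex functionals from real ones; separating a point from a closed subspace *)

Section Realification.
Context {R : realType}.

(** An alias, so that the same group can carry a second module structure, with real scalars. *)
Definition realification (X : lmodType R[i]) : Type := X.

Section Lmodule.
Variable X : lmodType R[i].

HB.instance Definition _ := GRing.Zmodule.on (realification X).

Let rscale (r : R) (x : realification X) : realification X := r%:C *: (x : X).

Let rscaleA (a b : R) x : rscale a (rscale b x) = rscale (a * b) x.
Proof. by rewrite /rscale scalerA rmorphM. Qed.

Let rscale1 : left_id 1 rscale.
Proof. by move=> x; rewrite /rscale rmorph1 scale1r. Qed.

Let rscaleDr : right_distributive rscale +%R.
Proof. by move=> a x y; rewrite /rscale scalerDr. Qed.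

Let rscaleDl x : {morph rscale^~ x : a b / a + b}.
Proof. by move=> a b; rewrite /rscale rmorphD scalerDl. Qed.

HB.instance Definition _ := GRing.Zmodule_isLmodule.Build R (realification X)
  rscaleA rscale1 rscaleDr rscaleDl.

Lemma realification_scaleE (r : R) (x : X) :
  r *: (x : realification X) = r%:C *: x.
Proof. by []. Qed.

End Lmodule.

(** This is [f x = g x - i g (i x)]; since [i (i x) = - x], it satisfies [f (i x) = i f x]. *)
Lemma complexification_scalar (X : lmodType R[i]) (g : realification X -> R) :
  scalar g -> linear (fun x : X => (g x +i* - g ('i%C *: x)) : R[i]^o).
Proof.
move=> sg.
have gD (x y : X) : g (x + y) = g x + g y.
  by have := sg 1 x y; rewrite scale1r mul1r.
have gZ (r : R) (x : X) : g (r%:C *: x) = r * g x.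
  have g0 : g 0 = 0 by apply: (addrI (g 0)); rewrite -gD !addr0.
  by have := sg r x 0; rewrite realification_scaleE !addr0 g0 addr0.
have gN x : g (- x) = - g x.
  by have := gZ (-1) x; rewrite rmorphN1 scaleN1r mulN1r.
have gC (a b : R) (x : X) : g ((a +i* b) *: x) = a * g x + b * g ('i%C *: x).
  rewrite (complexE (a +i* b)) scalerDl gD mulrC -scalerA !gZ.
  by [].
move=> [a b] x y.
have -> : 'i%C *: ((a +i* b) *: x + y) = (a +i* b) *: ('i%C *: x) + 'i%C *: y.
  by rewrite scalerDr !scalerA (mulrC 'i%C).
have iix : 'i%C *: ('i%C *: x) = - x by rewrite scalerA -expr2 sqr_i scaleN1r.
rewrite !gD (gC a b x) (gC a b ('i%C *: x)) iix gN.
apply/eqP; rewrite eq_complex /= !mulrN opprK.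
by rewrite eqxx /= !opprD opprK.
Qed.

(** The distance [p] to the subspace [I] is sublinear, zero on [I], and positive at [x] because [I]
    is closed. A real functional dominated by [p] and equal to it at [x] is then complexified. *)
Lemma dual_separates (X : normedModType R[i]) (I : set X) (x : X) :
  I 0 -> (forall y z, I y -> I z -> I (y + z)) ->
  (forall (k : R[i]) y, I y -> I (k *: y)) -> closed I -> ~ I x ->
  exists f : dual X, (forall y, I y -> f y = 0) /\ f x != 0.
Proof.
move=> I0 ID IZ cI Ix.
pose n (y : X) : R := complex.Re `|y|.
have nE y : (n y)%:C = `|y| by rewrite RRe_real// ger0_real.
have n0 y : 0 <= n y by rewrite -ler0c nE.
pose p (y : realification X) := inf [set n (y - z) | z in I].
have lbp y : has_lbound [set n (y - z) | z in I].
  by exists 0 => _ [z _ <-]; exact: n0.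
have ple (y z : X) : I z -> p y <= n (y - z).
  by move=> Iz; apply: ge_inf => //; exists z.
have sp : sublinear p.
  apply: (inf_sublinear _ I (fun z (y : realification X) => n ((y : X) - z))).
  - by exists 0.
  - by move=> y; exact: lbp.
  - move=> s t y z Is It; exists (s + t); first exact: ID.
    by rewrite -lecR rmorphD /= !nE opprD addrACA; exact: ler_normD.
  - move=> t r y r0 It; exists (r%:C *: t); first exact: IZ.
    rewrite realification_scaleE -lecR rmorphM /= !nE -scalerBr normrZ.
    by rewrite ger0_norm// lecR ltW.
have [g [sg gp gx]] := exists_dominated_scalar p x sp.
have gn y : g y <= n y.
  by apply: le_trans (gp y) _; have := ple y 0 I0; rewrite subr0.
have gN y : g (- y) = - g y.
  have g0 : g 0 = 0.
    by apply: (addrI (g 0)); have := sg 1 0 0; rewrite scaler0 !addr0 mul1r.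
  by have := sg (-1) y 0; rewrite scaleN1r !addr0 g0 addr0 mulN1r.
(* On [I] one has [g <= p <= 0], and [I] is stable under negation. *)
have gI y : I y -> g y = 0.
  have gI y' : I y' -> g y' <= 0.
    move=> Iy; apply: le_trans (gp y') _.
    by apply: le_trans (ple y' y' Iy) _; rewrite subrr /n normr0.
  move=> Iy; apply/eqP; rewrite eq_le gI//= -oppr_le0 -gN gI// -scaleN1r.
  exact: IZ.
have gabs (y : X) : `|g y| <= n y.
  rewrite ler_norml gn andbT lerNl -gN; apply: le_trans (gn _) _.
  by rewrite /n normrN.
have fb : (fun y : X => (g y +i* - g ('i%C *: y)) : R[i]^o)
    \in @bounded_linear R X R[i]^o.
  apply/asboolP; split; first exact: complexification_scalar.
  (* The real and imaginary parts are each bounded by the norm of [y], whence the constant 2. *)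
  exists 2 => y; rewrite [_ +i* _]complexE /=.
  apply: le_trans (ler_normD _ _) _; rewrite mulr_natl mulr2n.
  have gC (r : R) z : `|r| <= n z -> `|r%:C| <= `|z|.
    by rewrite -nE normc_def /= expr0n addr0 sqrtr_sqr lecR.
  apply: lerD; first exact: gC.
  have i1 : `|'i%C : R[i]| = 1.
    by rewrite normc_def /= expr0n expr1n add0r sqrtr1.
  rewrite normrM i1 mul1r gC// normrN; apply: le_trans (gabs _) _.
  by rewrite /n normrZ i1 mul1r.
exists (Blin fb); split=> [y Iy|] /=.
  by rewrite !gI ?oppr0//; exact: IZ.
(* A ball around [x] misses [I], and its radius bounds the distance from below. *)
have px0 : 0 < p x.
  have : nbhs x (~` I).
    by apply: open_nbhs_nbhs; split=> //; exact: closed_openC.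
  move=> /nbhs_normP[e /= e0 eI].
  have eE : (complex.Re e)%:C = e by rewrite RRe_real// gtr0_real.
  apply: (@lt_le_trans _ _ (complex.Re e)); first by rewrite -ltcR eE.
  apply: lb_le_inf; first by exists (n (x - 0)), 0.
  move=> _ [z Iz <-]; rewrite leNgt; apply/negP => nz; apply: (eI z) => //=.
  by rewrite -nE -eE ltcR.
by rewrite eq_complex /= negb_and gx gt_eqF.
Qed.

End Realification.

(** * Convergence in initial and pointwise topologies; images of ultrafilters *)

Lemma cvg_initial (S : choiceType) (T : topologicalType) (h : S -> T)
    (F : set_system S) (s : S) : Filter F ->
  h @ F --> h s -> F --> (s : initial_topology h).
Proof.
move=> FF hF U [? /= [[W oW <-]]] /= Ws /filterS; apply.
by apply: hF; exact: open_nbhs_nbhs.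
Qed.

Lemma cvg_ptws (U : Type) (V : topologicalType) (F : set_system (U -> V))
    (f : U -> V) : Filter F ->
  (forall t, g t @[g --> F] --> f t) -> F --> (f : {ptws U -> V}).
Proof.
move=> FF cF; apply/cvg_sup => t; apply: cvg_initial; exact: cF.
Qed.

(** For [A] in the finer filter [G], either the preimage of [A] or that of its complement lies in
    [F]; the latter would put the complement of [A] in [G] too. *)
Lemma ultra_fmap (S T : Type) (h : S -> T) (F : set_system S) :
  UltraFilter F -> UltraFilter (h @ F).
Proof.
move=> FU; have FF := @ultra_proper _ _ FU.
split; first exact: fmap_proper_filter.
move=> G GF FG; apply/seteqP; split=> // A GA.
have [//|FC] := in_ultra_setVsetC (h @^-1` A) FU.
have /filter_ex[t []] : G (A `&` ~` A) by apply: filterI => //; exact: FG.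
by [].
Qed.

(** * Weak and weak*-topologies *)

Section WeakTopologies.
Context {R : realType}.

(** Real and imaginary parts push [F] to ultrafilters on a compact real segment, and their two
    limits assemble into a complex one. *)
Lemma bounded_ultra_cvg (M : R[i]) (F : set_system R[i]^o) : UltraFilter F ->
  F [set z | `|z| <= M] -> exists l : R[i]^o, F --> l.
Proof.
move=> FU FM; have FF := @ultra_proper _ _ FU.
have [z0 z0M] := filter_ex FM.
have M0 : 0 <= M by apply: le_trans z0M.
pose m := complex.Re M.
have mE : m%:C = M by rewrite RRe_real// ger0_real.
have cpt (h : R[i] -> R) : (forall z, `|h z|%:C <= `|z|) ->
    exists l : R, h @ F --> l.
  move=> hz; have := @segment_compact R (- m) m; rewrite compact_ultra.
  have Fm : F (h @^-1` `[- m, m]%classic).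
    apply: filterS FM => z zM /=; rewrite in_itv /= -ler_norml -lecR mE.
    exact: le_trans (hz z) zM.
  by move=> /(_ _ (ultra_fmap _ _ h F FU) Fm)[l [_ hl]]; exists l.
have [a Fa] := cpt (@complex.Re R) (@normc_ge_Re R).
have [b Fb] : exists l : R, (@complex.Im R) @ F --> l.
  (* The imaginary part of [z] is, up to sign, the real part of [z * 'i], so the bound on real parts
     applies. *)
  apply: cpt => z; have := @normc_ge_Re R (z * 'i%C).
  have i1 : `|'i%C : R[i]| = 1.
    by rewrite normc_def /= expr0n expr1n add0r sqrtr1.
  by rewrite ReiNIm normrN normrM i1 mulr1.
exists (a +i* b); apply/cvgrPdist_le => e e0.
pose d := complex.Re e.
have dE : d%:C = e by rewrite RRe_real// gtr0_real.
have d0 : 0 < d / 2 by rewrite divr_gt0// -ltcR dE.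
have /cvgrPdist_le /(_ _ d0) {}Fa := Fa.
have /cvgrPdist_le /(_ _ d0) {}Fb := Fb.
apply: filterS (filterI Fa Fb) => -[x y] [/= ax byy].
have -> : e = (d / 2)%:C + (d / 2)%:C by rewrite -dE {1}[d]splitr rmorphD.
rewrite [_ - _]complexE /=.
have rE (r : R) : `|r%:C| = `|r|%:C.
  by rewrite normc_def /= expr0n addr0 sqrtr_sqr.
apply: le_trans (ler_normD _ _) _. apply: lerD; first by rewrite rE lecR.
rewrite normrM rE.
have -> : `|'i%C : R[i]| = 1.
  by rewrite normc_def /= expr0n expr1n add0r sqrtr1.
by rewrite mul1r lecR.
Qed.

Lemma lipschitz_continuous (K : numFieldType) (X Y : normedModType K)
    (h : X -> Y) (k : K) : 0 <= k ->
  (forall x y, `|h x - h y| <= k * `|x - y|) -> continuous h.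
Proof.
move=> k0 hk x; apply/(@cvgrPdist_le _ _ _ (nbhs x)) => e e0.
(* Dividing by [k + 1] rather than [k] covers the case [k = 0]. *)
apply/nbhs_normP; exists (e / (k + 1)) => /=.
  by rewrite divr_gt0// ltr_wpDl.
move=> y /= /ltW xy; apply: le_trans (hk x y) _.
rewrite (@le_trans _ _ (k * (e / (k + 1))))//; first by rewrite ler_wpM2l.
by rewrite mulrCA ler_piMr ?ltW// ltr_pdivrMr ?ltr_wpDl// mul1r ltrDl.
Qed.

Lemma dual_eval_continuous (X : normedModType R[i]) (x : X) :
  continuous ((fun f => f x) : dual X -> R[i]^o).
Proof.
apply: (@lipschitz_continuous _ _ _ _ `|x|) => // f g.
by rewrite mulrC; exact: (ler_opnorm (f - g) x).
Qed.

Lemma weak_continuous_dual (X : normedModType R[i]) (f : dual X) :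
  continuous ((fun x => f x) : weak X -> R[i]^o).
Proof.
have h : continuous ((fun x (g : dual X) => g x) :
    weak X -> {ptws dual X -> R[i]^o}) by exact: initial_continuous.
move=> x; have pc := @proj_continuous (dual X) (fun=> R[i]^o) f.
exact: (continuous_comp (h x) (pc _)).
Qed.

(** The weak topology is Hausdorff: [dual_separates] for the closed subspace [[set 0]] yields a
    functional telling [x] from [y], while scalar limits are unique. *)
Lemma weak_cvg_unique (X : normedModType R[i]) (F : set_system X) (x y : X) :
  ProperFilter F -> F --> (x : weak X) -> F --> (y : weak X) -> x = y.
Proof.
move=> FF Fx Fy; apply/eqP; rewrite -subr_eq0; apply/eqP; apply: contrapT => xy.
have [f [_]] : exists f : dual X,
    (forall z, [set 0] z -> f z = 0) /\ f (x - y) != 0.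
  apply: dual_separates => //.
  - by move=> _ _ -> ->; rewrite /= addr0.
  - by move=> k _ ->; rewrite /= scaler0.
  - exact/accessible_closed_set1/hausdorff_accessible/norm_hausdorff.
rewrite linearB subr_eq0 => /eqP; apply.
apply: (@cvg_unique _ (@norm_hausdorff _ R[i]^o) (f z @[z --> F])).
  exact: (cvg_comp _ _ Fx (weak_continuous_dual _ f x)).
exact: (cvg_comp _ _ Fy (weak_continuous_dual _ f y)).
Qed.

Lemma norm_weak_cvg (X : normedModType R[i]) (F : set_system X) (x : X) :
  Filter F -> F --> x -> F --> (x : weak X).
Proof.
move=> FF Fx; apply: cvg_initial; apply: cvg_ptws => f.
have fc : continuous f.
  apply: (@lipschitz_continuous _ _ _ _ (opnorm f)) => [|a b].
    exact: opnorm_ge0.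
  by rewrite -linearB; exact: ler_opnorm.
exact: (cvg_comp _ _ Fx (fc x)).
Qed.

Context {B : normedModType R[i]} (P : predual B).

Lemma wstar_cvg (F : set_system B) (b : B) : Filter F ->
  (forall x, pd_iso P m x @[m --> F] --> (pd_iso P b x : R[i]^o)) ->
  F --> (b : wstar P).
Proof.
(* One initial topology comes from the transport along [pd_iso], the other from the evaluations
   defining [weakstar]. *)
move=> FF h; apply: cvg_initial; apply: cvg_initial.
exact: cvg_ptws.
Qed.

Lemma wstar_continuous_eval (x : pd_space P) :
  continuous ((fun m => pd_iso P m x) : wstar P -> R[i]^o).
Proof.
move=> m.
have h1 : continuous (pd_iso P : wstar P -> weakstar (pd_space P)).
  exact: initial_continuous.
have h2 : continuous ((fun f (x : pd_space P) => f x) :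
    weakstar (pd_space P) -> {ptws pd_space P -> R[i]^o}).
  exact: initial_continuous.
have h3 := @proj_continuous (pd_space P) (fun=> R[i]^o) x.
exact: (continuous_comp (h1 m) (continuous_comp (h2 _) (h3 _))).
Qed.

Lemma wstar_continuous (T : topologicalType) (h : T -> wstar P) :
  (forall x, continuous ((fun t => pd_iso P (h t) x) : T -> R[i]^o)) ->
  continuous h.
Proof.
by move=> hc t; apply: wstar_cvg => x; exact: hc.
Qed.

Lemma norm_wstar_continuous : continuous (id : B -> wstar P).
Proof.
apply: wstar_continuous => x b.
apply: (@continuous_comp _ _ _ (pd_iso P) (fun f : dual (pd_space P) => f x)).
  exact: pd_iso_continuous.
exact: dual_eval_continuous.
Qed.

Lemma wstar_addr_continuous (b : B) :
  continuous ((fun m => m + b) : wstar P -> wstar P).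
Proof.
apply: wstar_continuous => x m.
have -> : (fun t : wstar P => pd_iso P (t + b) x) =
          (fun t : wstar P => (pd_iso P t x : R[i]^o) + pd_iso P b x).
  by apply/funext => t; rewrite linearD.
exact: (cvgD (wstar_continuous_eval x m) (cvg_cst _)).
Qed.

Lemma wstar_scale_continuous (k : R[i]) :
  continuous ((fun m => k *: m) : wstar P -> wstar P).
Proof.
apply: wstar_continuous => x m.
have -> : (fun t : wstar P => pd_iso P (k *: t) x) =
          (fun t : wstar P => k *: (pd_iso P t x : R[i]^o)).
  by apply/funext => t; rewrite linearZ.
exact: (cvgZr (wstar_continuous_eval x m)).
Qed.

(* Banach-Alaoglu, in ultrafilter form *)
Lemma bounded_ultra_wstar_cvg (M : R[i]) (F : set_system B) : UltraFilter F ->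
  F [set b | `|b| <= M] -> exists b : B, F --> (b : wstar P).
Proof.
move=> FU FM; have FF := @ultra_proper _ _ FU.
have [b0 b0M] := filter_ex FM.
have M0 : 0 <= M by apply: le_trans b0M.
have [N N0 isoN] :
    exists2 N : R[i], 0 <= N & forall b, `|pd_iso P b| <= N * `|b|.
  have := (linear_bounded_continuous (pd_iso P)).2 (@pd_iso_continuous _ _ P).
  by move=> /linear_boundedP/pinfty_ex_gt0[N /ltW N0 h]; exists N.
have FNM (x : pd_space P) :
    \forall b \near F, `|pd_iso P b x : R[i]^o| <= N * M * `|x|.
  apply: filterS FM => b bM; apply: le_trans (ler_opnorm _ _) _.
  by rewrite ler_wpM2r//; apply: le_trans (isoN b) _; rewrite ler_wpM2l.
have cF (x : pd_space P) : cvg ((pd_iso P b x : R[i]^o) @[b --> F]).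
  have [l Fl] := bounded_ultra_cvg (N * M * `|x|) _
    (ultra_fmap _ _ (fun b => pd_iso P b x : R[i]^o) F FU) (FNM x).
  by apply/cvg_ex; exists l.
(* The limit is built pointwise on the predual and carried back to [B] by [pd_inv]. *)
pose g (x : pd_space P) := lim ((pd_iso P b x : R[i]^o) @[b --> F]).
have gb : g \in @bounded_linear R (pd_space P) R[i]^o.
  apply/asboolP; split.
    move=> k x y.
    apply: (@cvg_unique _ (@norm_hausdorff _ R[i]^o)
      ((pd_iso P b (k *: x + y) : R[i]^o) @[b --> F])); first exact: cF.
    have -> : (fun b => pd_iso P b (k *: x + y) : R[i]^o) =
        (fun b => k *: (pd_iso P b x : R[i]^o) + pd_iso P b y).
      by apply/funext => b; rewrite linearP.
    by apply: cvgD; [apply: cvgZr; exact: cF|exact: cF].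
  exists (N * M) => x; apply/ler_addgt0Pr => e e0.
  have /cvgrPdist_le /(_ _ e0) gx : (pd_iso P b x : R[i]^o) @[b --> F] --> g x.
    exact: cF.
  have [b [/= gb bNM]] := filter_ex (filterI gx (FNM x)).
  rewrite -[g x](subrK (pd_iso P b x : R[i]^o)) addrC.
  by apply: le_trans (ler_normD _ _) _; apply: lerD.
exists (@pd_inv R B P (Blin gb)); apply: wstar_cvg => x.
by rewrite pd_invK; exact: cF.
Qed.

End WeakTopologies.

(** * Filters of tails, and closures under continuous maps *)

Lemma tails_proper_filter (T : Type) (le : T -> T -> Prop) :
  directed_preorder le -> ProperFilter (tails le).
Proof.
move=> [[t0] lexx letr ledir]; split.
  by move=> [t /(_ t (lexx t))].
split.
- by exists t0.
- move=> S U [s Ss] [u Uu]; have [t [st ut]] := ledir s u.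
  by exists t => v tv; split; [apply: Ss|apply: Uu]; apply: letr tv.
- by move=> S U SU [s Ss]; exists s => t st; apply: SU; exact: Ss.
Qed.

(** The preimage of [C] is closed and contains [D]. In this form a property checked on the image of
    an ideal passes to its weak*-closure. *)
Lemma closure_sub_preimage (S T : topologicalType) (h : S -> T)
    (D : set S) (C : set T) : continuous h -> closed C ->
  (forall x, D x -> C (h x)) -> forall x, closure D x -> C (h x).
Proof.
move=> hc cC DC x Dx; have cp : closed (h @^-1` C).
  exact: (closed_comp _ cC).
have := @closureS _ D (h @^-1` C) DC x Dx.
by rewrite -((closure_id _).1 cp).
Qed.

(** * Multipliers acting on [A] and on its canonical image *)

Section MultiplierIdeals.
Context {R : realType} {A : banachAlgType R[i]}.
Implicit Types (m n : multiplier A) (a b x : A) (I : set A).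

Lemma mult_of_lipschitz a b : `|mult_of a - mult_of b| <= `|a - b|.
Proof.
have -> : mult_of a - mult_of b = mult_of (a - b).
  by apply: mult_eq => c; rewrite /multL /multR /= ?bamulBl ?bamulBr.
apply: multnorm_le; apply: opnorm_le => // c.
  exact: ler_norm_bamul.
by rewrite mulrC; exact: ler_norm_bamul.
Qed.

(** After multiplication by any [c] on the left, [multP] moves [m] onto [c] and both sides agree;
    faithfulness cancels [c]. *)
Lemma multL_bamul m a b : faithful A -> multL m (a ** b) = multL m a ** b.
Proof.
move=> fA; apply/eqP; rewrite -subr_eq0; apply/eqP; apply: (fA _).1 => c.
by rewrite bamulBr multP !bamulA multP subrr.
Qed.

Lemma multR_bamul m a b : faithful A -> multR m (a ** b) = a ** multR m b.
Proof.
move=> fA; apply/eqP; rewrite -subr_eq0; apply/eqP; apply: (fA _).2 => c.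
by rewrite bamulBl -multP -!bamulA -multP subrr.
Qed.

(** With [mult_of_multm], this makes the image of [A] absorb products with multipliers on both
    sides. *)
Lemma multm_mult_of m a : faithful A -> m ** mult_of a = mult_of (multL m a).
Proof.
move=> fA; apply: mult_eq => b; rewrite /multL /multR /=.
  exact: multL_bamul.
exact/esym/multP.
Qed.

Lemma mult_of_multm m a : faithful A -> mult_of a ** m = mult_of (multR m a).
Proof.
move=> fA; apply: mult_eq => b; rewrite /multL /multR /=.
  exact: multP.
exact: multR_bamul.
Qed.

Lemma mult_of_bamul a b : mult_of (a ** b) = mult_of a ** mult_of b.
Proof.
by apply: mult_eq => c; rewrite /multL /multR /= bamulA.
Qed.

Lemma mult_ofD a b : mult_of (a + b) = mult_of a + mult_of b.
Proof.
by apply: mult_eq => c; rewrite /multL /multR /= ?bamulDl ?bamulDr.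
Qed.

Lemma mult_ofZ (k : R[i]) a : mult_of (k *: a) = k *: mult_of a.
Proof.
by apply: mult_eq => c; rewrite /multL /multR /= ?bamulZl ?bamulZr.
Qed.

Lemma mult_of0 : mult_of (0 : A) = 0.
Proof. by have := mult_ofZ 0 (0 : A); rewrite !scale0r. Qed.

(** Writing [m x] as the limit of [m (e_t x) = (m e_t) x] exhibits it as a limit of elements of
    [I]. *)
Lemma closed_left_ideal_multL I m x : faithful A ->
  has_bounded_approximate_identity A -> closed_left_ideal I ->
  I x -> I (multL m x).
Proof.
move=> fA [T [le [e [dT _ eP]]]] [[I0 ID IZ IM] cI] Ix.
have FT := tails_proper_filter _ _ dT.
apply: (@closed_cvg _ _ (tails le) _ (fun t => multL m (e t ** x)) I cI).
  by apply: nearW => t; rewrite multL_bamul//; exact: IM.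
have cm : continuous (multL m).
  apply: (@lipschitz_continuous _ _ _ _ (opnorm (multL m))) => [|a b].
    exact: opnorm_ge0.
  by rewrite -linearB; exact: ler_opnorm.
exact: (cvg_comp _ _ (eP x).1 (cm x)).
Qed.

(** * The two maps between ideals of [A] and weak*-closed ideals of [M(A)] *)

Section Dual.
Variable P : predual (multiplier A).

Lemma mult_of_wstar_continuous :
  continuous (mult_of (A:=A) : A -> wstar P).
Proof.
move=> a; apply: (@continuous_comp _ _ _ (mult_of (A:=A)) (id : _ -> wstar P)).
  apply: (@lipschitz_continuous _ _ _ _ 1) => // b c; rewrite mul1r.
  exact: mult_of_lipschitz.
exact: norm_wstar_continuous.
Qed.

Lemma wstar_closure_left_ideal I : compliant P ->
  has_bounded_approximate_identity A -> closed_left_ideal I ->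
  wstar_closed_left_ideal P (wstar_closure P (mult_of (A:=A) @` I)).
Proof.
move=> [fA dP _] bai cI; have [[I0 ID IZ IM] _] := cI.
set J := mult_of (A:=A) @` I.
have cJ : @closed (wstar P) (@closure (wstar P) J) by exact: closed_closure.
have sJ m : J m -> wstar_closure P J m by exact: (@subset_closure (wstar P)).
split; last exact: cJ.
split.
- by apply: sJ; exists 0 => //; exact: mult_of0.
(* Addition is treated one variable at a time: first with one summand in [J], then with both in the
   closure. *)
- have h m n : J m -> wstar_closure P J n -> wstar_closure P J (n + m).
    move=> [a Ia <-]; apply: (@closure_sub_preimage (wstar P) (wstar P)
      (fun n => n + mult_of a) J _ _ cJ) => //.
      exact: wstar_addr_continuous.
    move=> _ [b Ib <-]; apply: sJ; exists (b + a); first exact: ID.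
    exact: mult_ofD.
  move=> m n mJ; rewrite addrC.
  apply: (@closure_sub_preimage (wstar P) (wstar P)
      (fun n => n + m) J _ _ cJ).
    exact: wstar_addr_continuous.
  by move=> n' Jn'; rewrite addrC; exact: h.
- move=> k; apply: (@closure_sub_preimage (wstar P) (wstar P)
      (fun n => k *: n) J _ _ cJ).
    exact: wstar_scale_continuous.
  move=> _ [b Ib <-]; apply: sJ; exists (k *: b); first exact: IZ.
  exact: mult_ofZ.
- move=> n; apply: (@closure_sub_preimage (wstar P) (wstar P)
      (fun m => n ** m) J _ _ cJ).
    exact: (dP n).1.
  move=> _ [b Ib <-]; apply: sJ; exists (multL n b).
    exact: closed_left_ideal_multL.
  by rewrite multm_mult_of.
Qed.

Lemma wstar_closure_preimage I : compliant P ->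
  has_bounded_approximate_identity A -> closed_left_ideal I ->
  mult_of (A:=A) @^-1` wstar_closure P (mult_of (A:=A) @` I) = I.
Proof.
move=> [fA dP cP] [T [le [e [dT _ eP]]]] [[I0 ID IZ IM] cI].
apply/seteqP; split=> [a Ja|a Ia]; last first.
  by apply: (@subset_closure (wstar P)); exists a.
(* If [b ** a] were outside [I], a functional [f] would vanish on [I] but not at [b ** a]. Then
   [m |-> f (multR m b)] is weak*-continuous and zero on the image of the left ideal [I], hence zero
   at [mult_of a], where its value is [f (b ** a)]. *)
have baI b : I (b ** a).
  apply: contrapT => Iba.
  have [f [fI fba]] := dual_separates _ _ _ I0 ID IZ cI Iba.
  have fc : continuous ((fun m => f (multR m b)) : wstar P -> R[i]^o).
    move=> m.
    exact: (continuous_comp ((cP b).2 m) (weak_continuous_dual _ f _)).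
  move: fba => /eqP; apply.
  apply: (@closure_sub_preimage (wstar P) R[i]^o _ (mult_of (A:=A) @` I)
    [set 0] fc _ _ (mult_of a)) => //.
    exact/accessible_closed_set1/hausdorff_accessible/norm_hausdorff.
  by move=> _ [c Ic <-]; apply: fI; exact: IM.
have FT := tails_proper_filter _ _ dT.
apply: (@closed_cvg _ _ (tails le) _ (fun t => e t ** a) I cI).
  by apply: nearW => t; exact: baI.
exact: (eP a).1.
Qed.

Lemma mult1_wstar_limit : compliant P -> has_bounded_approximate_identity A ->
  exists U : set_system (multiplier A),
    [/\ ProperFilter U, U (range (mult_of (A:=A))) &
      U --> (mult1 A : wstar P)].
Proof.
move=> [fA dP cP] [T [le [e [dT [M eM] eP]]]].
have FT := tails_proper_filter _ _ dT.
pose F := (fun t => mult_of (e t)) @ tails le.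
have FF : ProperFilter F by exact: fmap_proper_filter.
(* Refining the net to an ultrafilter turns a cluster point into a limit. *)
have [U [UU FU]] := ultraFilterLemma FF.
have PU := @ultra_proper _ _ UU.
have nearU S : (forall t, S (mult_of (e t))) -> U S.
  move=> eS; apply: FU.
  exact: (@filterS _ (tails le) _ setT _ (fun t _ => eS t) filterT).
have UM : U [set m | `|m| <= M].
  apply: nearU => t; apply: le_trans (eM t).
  rewrite -[mult_of (e t)]subr0 -mult_of0 (le_trans (mult_of_lipschitz _ _))//.
  by rewrite subr0.
have [E UE] := bounded_ultra_wstar_cvg P M U UU UM.
exists U; split=> //.
  by apply: nearU => t; exists (e t).
suff <- : E = mult1 A by [].
(* Along [U], [multL m a] tends weakly to [multL E a] and in norm to [a], so the two coincide;
   likewise on the right. *)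
apply: mult_eq => a.
  apply: (weak_cvg_unique _ ((fun m => multL m a) @ U)).
    exact: (cvg_comp _ _ UE ((cP a).1 E)).
  apply: norm_weak_cvg; apply: cvg_trans (eP a).1.
  move=> S; exact: FU.
apply: (weak_cvg_unique _ ((fun m => multR m a) @ U)).
  exact: (cvg_comp _ _ UE ((cP a).2 E)).
apply: norm_weak_cvg; apply: cvg_trans (eP a).2.
move=> S; exact: FU.
Qed.

Lemma preimage_closed_left_ideal (J : set (multiplier A)) :
  wstar_closed_left_ideal P J -> closed_left_ideal (mult_of (A:=A) @^-1` J).
Proof.
move=> [[J0 JD JZ JM] cJ]; split; last first.
  by apply: (closed_comp _ cJ) => a _; exact: mult_of_wstar_continuous.
split=> [|a b Ja Jb|k a Ja|a b Jb] /=.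
- by rewrite mult_of0.
- by rewrite mult_ofD; exact: JD.
- by rewrite mult_ofZ; exact: JZ.
- by rewrite mult_of_bamul; exact: JM.
Qed.

Lemma wstar_closure_image_preimage (J : set (multiplier A)) : compliant P ->
  has_bounded_approximate_identity A -> wstar_closed_left_ideal P J ->
  wstar_closure P (mult_of (A:=A) @` (mult_of (A:=A) @^-1` J)) = J.
Proof.
move=> cP bai [[J0 JD JZ JM] cJ]; apply/seteqP; split.
  rewrite [X in _ `<=` X](@closure_id (wstar P) J).1//.
  by apply: (@closureS (wstar P)) => _ [a Ja <-].
have [U [PU Ur U1]] := mult1_wstar_limit cP bai.
have [fA dP _] := cP.
move=> m Jm; rewrite -(mult1m m).
(* For [n] in the image of [A], the product [n ** m] lies both in that image and in [J]; along [U]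
   it tends weak* to [mult1 ** m]. *)
apply: (@closed_cvg _ (wstar P) U _ (fun n => n ** m)); last first.
- exact: (cvg_comp _ _ U1 ((dP m).2 (mult1 A))).
- apply: filterS Ur => _ [a _ <-]; apply: (@subset_closure (wstar P)).
  by rewrite mult_of_multm//; exists (multR m a) => //=;
    rewrite -mult_of_multm//; exact: JM.
- exact: (@closed_closure (wstar P)).
Qed.

End Dual.
End MultiplierIdeals.

Theorem theorem5p10 (R : realType) (A : banachAlgType R[i])
    (P : predual (multiplier A)) :
  compliant P -> has_bounded_approximate_identity A ->
  [/\ set_bij [set I : set A | closed_left_ideal I]
        [set J : set (multiplier A) | wstar_closed_left_ideal P J]
        (fun I => wstar_closure P (mult_of (A:=A) @` I)),
      (forall I : set A, closed_left_ideal I ->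
        mult_of (A:=A) @^-1` wstar_closure P (mult_of (A:=A) @` I) = I) &
      (forall J : set (multiplier A), wstar_closed_left_ideal P J ->
        closed_left_ideal (mult_of (A:=A) @^-1` J) /\
        wstar_closure P (mult_of (A:=A) @` (mult_of (A:=A) @^-1` J)) = J)].
Proof.
move=> cP bai.
have KI I : closed_left_ideal I -> _ := wstar_closure_preimage P I cP bai.
have KJ J : wstar_closed_left_ideal P J -> _ :=
  wstar_closure_image_preimage P J cP bai.
split=> [|//|J cJ]; last first.
  by split; [exact: preimage_closed_left_ideal cJ|exact: KJ].
split=> [I cI|I1 I2|J cJ] /=.
- exact: wstar_closure_left_ideal.
(* Injectivity follows from the left inverse [KI]. *)
- by rewrite !inE => /= cI1 cI2 I12; rewrite -(KI _ cI1) I12 KI.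
- exists (mult_of (A:=A) @^-1` J); last exact: KJ.
  exact: preimage_closed_left_ideal cJ.
Qed.
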